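(* Let $\mathbb X,\mathbb Y$ be finite-dimensional Hilbert spaces, $\lambda>0$, $b\in\mathbb Y$. Let $f:\mathbb X\to\mathbb R\cup\{+\infty\}$ be proper, lower semicontinuous and prox-bounded with threshold $\lambda_f>\lambda$, let $A:\mathbb X\to\mathbb Y$ be a surjective linear operator, let $\mathcal E=\{x\in\mathbb X:Ax=b\}$, and let $\bar x\in\mathcal F:=\mathcal E\cap\operatorname{dom} f$ (so $\mathcal F\neq\emptyset$). Suppose that: (i) $f$ and $\delta_{\mathcal E}$ satisfy the nonconvex subdifferential sum rule (NSSR) at $\bar x$; (ii) $f$ is prox-regular at $\bar x$ for $\bar v=0$ with constant $\rho\in(0,1/\lambda)$, and $\bar x=\operatorname{Prox}_{f/\rho}(\bar x)$. Then the problem $\min_{x\in\mathbb X}\{\lambda f(x)+\tfrac12\|x-z\|^2:Ax=b\}$ is dual-representable for all $z$ near $\bar x$; that is, there is $\epsilon>0$ such that it is dual-representable at every $z$ with $\|z-\bar x\|<\epsilon$.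
   Context: $\delta_{\mathcal E}$ is the indicator function of $\mathcal E$; $A^*$ is the adjoint of $A$; $\mathbb B_r(x)$ is the open ball of radius $r$ about $x$; $\partial$ denotes the limiting (Mordukhovich) subdifferential. $E_h(t)=\inf_x\{h(x)+\tfrac12\|x-t\|^2\}$ and $\operatorname{Prox}_h(t)=\arg\min_x\{h(x)+\tfrac12\|x-t\|^2\}$ (set-valued); $\bar x=\operatorname{Prox}_{f/\rho}(\bar x)$ means that $\operatorname{Prox}_{f/\rho}(\bar x)=\{\bar x\}$. Prox-bounded: there is $\gamma>0$ with $E_{\gamma f}(x)>-\infty$ for some $x$; the threshold $\lambda_f$ is the supremum of all such $\gamma$. NSSR: lsc functions $f,g:\mathbb X\to\overline{\mathbb R}$ satisfy NSSR at $\bar x\in\operatorname{dom} f\cap\operatorname{dom} g$ if there exist $\tau,\delta\in(0,\infty)$ such that $\partial(f+g)(x)\cap\mathbb B_d(0)\subseteq\partial f(x)\cap\tau\mathbb B_d(0)+\partial g(x)\cap\tau\mathbb B_d(0)$ for all $x\in\mathbb B_\delta(\bar x)\cap\operatorname{dom} f\cap\operatorname{dom} g$ and all $d\in(0,1]$. Prox-regularity: $f$ is prox-regular at $\bar x$ for $\bar v$ with constant $\rho$ if $f$ is finite and locally lsc at $\bar x$, $\bar v\in\partial f(\bar x)$, and there is $\epsilon>0$ such that $f(x')\ge f(x)+\langle v,x'-x\rangle-\frac\rho2\|x'-x\|^2$ for all $x'\in\mathbb B_\epsilon(\bar x)$ whenever $x\in\mathbb B_\epsilon(\bar x)$, $f(x)<f(\bar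 x)+\epsilon$, $v\in\partial f(x)\cap\mathbb B_\epsilon(\bar v)$. The problem $\min_x\{\lambda f(x)+\tfrac12\|x-z\|^2: Ax=b\}$ is dual-representable at $z$ if there exists $y^*\in\mathbb Y$ such that $0\in A\,\operatorname{Prox}_{\lambda f}(z+A^*y^* )-b$ (equivalently, the problem and its Lagrangian dual both attain their optimal values, with zero duality gap). *)

(* Defs.v *)
From HB Require Import structures.
From mathcomp Require Import all_boot all_order all_algebra.
From mathcomp Require Import all_classical all_reals all_analysis.

Set Implicit Arguments.
Unset Strict Implicit.
Unset Printing Implicit Defensive.

Import Order.TTheory GRing.Theory Num.Theory.
Import numFieldNormedType.Exports.

Local Open Scope classical_set_scope.
Local Open Scope ring_scope.

(* Finite-dimensional real Hilbert spaces: the norm (hence the topology) of the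
   normed module is the one induced by the inner product. Completeness is
   automatic in finite dimension. *)
HB.mixin Record NormedVector_hasInner (R : realType) V
    & NormedModule R V & Vector R V := {
  inner : {dot V for idfun};
  inner_norm : forall x : V, inner x x = `|x| ^+ 2
}.

#[short(type="euclideanType")]
HB.structure Definition Euclidean (R : realType) :=
  {V of NormedModule R V & Vector R V & NormedVector_hasInner R V}.

Section InnerProduct.
Variables (R : realType) (X : euclideanType R).
Implicit Types x y z : X.

Lemma innerC x y : inner x y = inner y x.
Proof. by rewrite hermC expr0 mul1r. Qed.

Lemma innerDl x y z : inner (x + y) z = inner x z + inner y z.
Proof. exact: linearDl. Qed.

Lemma innerDr x y z : inner z (x + y) = inner z x + inner z y.
Proof. by rewrite !(innerC z) innerDl. Qed.

Lemma innerZl a x y : inner (a *: x) y = a * inner x y.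
Proof. exact: linearZl_LR. Qed.

Lemma innerZr a x y : inner x (a *: y) = a * inner x y.
Proof. by rewrite !(innerC x) innerZl. Qed.

Lemma inner_suml (I : finType) (F : I -> X) y :
  inner (\sum_i F i) y = \sum_i inner (F i) y.
Proof.
apply: (big_morph (fun x => inner x y)) => [u v|]; first exact: innerDl.
by rewrite -(scale0r (0 : X)) innerZl mul0r.
Qed.

Lemma inner_eq0 x : (inner x x == 0) = (x == 0).
Proof. by rewrite inner_norm sqrf_eq0 normr_eq0. Qed.

End InnerProduct.

Section Adjoint.
Variables (R : realType) (X Y : euclideanType R).

Definition adjoint (A : {linear X -> Y}) (y : Y) : X :=
  xget 0 [set x | forall u, inner u x = inner (A u) y].

Lemma adjointP (A : {linear X -> Y}) y u :
  inner u (adjoint A y) = inner (A u) y.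
Proof.
suff [x Hx] : exists x : X, forall u, inner u x = inner (A u) y.
  rewrite /adjoint; case: xgetP => [_ _ -> //|/(_ x)[]]; exact: Hx.
pose e := vbasis {:X}; pose n := \dim {:X}.
have span_e v : v = \sum_i coord e i v *: e`_i.
  by rewrite -coord_vbasis ?memvf.
pose phi (x : X) : 'rV[R]_n := \row_i inner e`_i x.
have lphi : linear phi.
  move=> a x x'; apply/rowP => i.
  by rewrite !mxE innerDr innerZr.
pose PhiL := GRing.isLinear.Build R X _ _ phi lphi.
pose Phi : {linear X -> 'rV[R]_n} := HB.pack phi PhiL.
pose L := linfun Phi.
have kL : lker L == 0%VS.
  rewrite -subv0; apply/subvP => x; rewrite memv_ker lfunE /= memv0 => /eqP Lx0.
  rewrite -inner_eq0 {1}(span_e x) inner_suml big1 // => i _.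
  have := congr1 (fun r : 'rV[R]_n => r 0 i) Lx0.
  by rewrite !mxE innerZl => ->; rewrite mulr0.
have dL : (limg L = fullv)%VS.
  apply/eqP; rewrite eqEdim subvf /= limg_dim_eq; last first.
    by rewrite (eqP kL) capv0.
  by rewrite dimvf /dim /= mul1n.
pose t : 'rV[R]_n := \row_i inner (A e`_i) y.
have /memv_imgP[x _ tx] : t \in limg L by rewrite dL memvf.
exists x => v; rewrite (span_e v) inner_suml linear_sum inner_suml.
apply: eq_bigr => i _; rewrite linearZ !innerZl; congr (_ * _).
have := congr1 (fun r : 'rV[R]_n => r 0 i) tx.
by rewrite lfunE !mxE => ->.
Qed.

End Adjoint.

Local Open Scope ereal_scope.

Section VariationalAnalysis.
Variables (R : realType) (X : euclideanType R).
Implicit Types (f g h : X -> \bar R) (x t v : X).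

Definition edom f : set X := [set x | f x < +oo].

Definition indicator_fun (E : set X) : X -> \bar R :=
  fun x => if `[< E x >] then 0 else +oo.

Definition escale (c : R) f : X -> \bar R := fun x => c%:E * f x.

Definition prox_objective h t : X -> \bar R :=
  fun x => h x + (2^-1 * `|x - t| ^+ 2)%R%:E.

Definition moreau_env h t : \bar R := ereal_inf (range (prox_objective h t)).

Definition prox h t : set X :=
  [set x | forall y, prox_objective h t x <= prox_objective h t y].

Definition prox_bound f : set R :=
  [set c | (0 < c)%R /\ exists x, -oo < moreau_env (escale c f) x].

Definition prox_bounded f : Prop := prox_bound f !=set0.

Definition prox_threshold f : \bar R :=
  ereal_sup [set c%:E | c in prox_bound f].

(* f y >= f x + <v, y - x> + o(|y - x|) as y -> x *)
Definition regular_subdiff f x : set X :=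
  [set v | f x \is a fin_num /\
    forall e : R, (0 < e)%R ->
      \forall y \near x,
        f x + (inner v (y - x)%R - e * `|y - x|)%R%:E <= f y].

Definition limiting_subdiff f x : set X :=
  [set v | f x \is a fin_num /\
    exists (u w : nat -> X),
      [/\ u @ \oo --> x, f (u n) @[n --> \oo] --> f x,
          forall n, regular_subdiff f (u n) (w n) & w @ \oo --> v]].

(* Rockafellar and Wets, Variational Analysis, Definition 1.33 *)
Definition locally_lsc_at f x : Prop :=
  exists2 e : R, (0 < e)%R &
    forall a : R, a%:E <= f x + e%:E ->
      closed (closed_ball x e `&` [set y | f y <= a%:E]).

Definition prox_regular f x v (rho : R) : Prop :=
  [/\ f x \is a fin_num, locally_lsc_at f x, limiting_subdiff f x v &
    exists2 e : R, (0 < e)%R &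
      forall y w, ball x e y -> f y < f x + e%:E ->
        limiting_subdiff f y w -> ball v e w ->
        forall y', ball x e y' ->
          f y + (inner w (y' - y)%R - rho / 2 * `|y' - y| ^+ 2)%R%:E <= f y'].

(* nonconvex subdifferential sum rule *)
Definition NSSR f g x : Prop :=
  exists tau delta : R, [/\ (0 < tau)%R, (0 < delta)%R &
    forall (y : X) (d : R), ball x delta y -> edom f y -> edom g y ->
      (0 < d <= 1)%R ->
      let tauB := [set (tau *: u)%R | u in ball (0%R : X) d] in
      limiting_subdiff (f \+ g) y `&` ball (0%R : X) d `<=`
      [set (u + w)%R | u in limiting_subdiff f y `&` tauB
                     & w in limiting_subdiff g y `&` tauB]].

End VariationalAnalysis.

(* Dual representability at z of the problem of minimizing
   lam * f x + |x - z|^2 / 2 subject to A x = b. *)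
Definition dual_representable (R : realType) (X Y : euclideanType R)
    (f : X -> \bar R) (A : {linear X -> Y}) (b : Y) (lam : R) (z : X) : Prop :=
  exists y : Y,
    [set (A x - b)%R | x in prox (escale lam f) (z + adjoint A y)%R] 0%R.

(* Main.v *)
From HB Require Import structures.
Require Import Defs.
From mathcomp Require Import all_boot all_order all_algebra.
From mathcomp Require Import all_classical all_reals all_analysis.
From mathcomp Require Import ring lra.

(** The condition that [xbar] is the proximal point of [f / rho] at itself is a
    global statement: [f y >= f xbar - rho / 2 |y - xbar|^2] for every [y]. Since
    [lam * rho < 1], adding [|y - z|^2 / (2 lam)] to this minorant gives a strongly
    convex function. Therefore the constrained problem at [z] has a minimizer
    [x], and [x] tends to [xbar] at a linear rate as [z] does
    ([constrained_min_near]).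

    Optimality of [x] says that [v = (z - x) / lam], a short vector, is a regular
    subgradient of [f] plus the indicator of the affine set at [x]
    ([constrained_min_regular_subdiff]). The sum rule splits it as [v = u + w],
    where [u] is a short subgradient of [f] at [x] and [w] is a normal vector of
    the affine set, hence of the form [A^* y] ([limiting_subdiff_affine],
    [kernel_orthogonal_range_adjoint]).

    Prox-regularity supplies a quadratic minorant of [f] with slope [u] at [x] and
    curvature [rho], valid near [xbar]. Far from [xbar] the global minorant above
    takes over, because its curvature [rho] is strictly smaller than [1 / lam] and
    all the errors are small ([local_to_global_minorant]). Thus [x] belongs to the
    proximal set of [lam f] at [x + lam u = z - lam w = z + A^* (- lam y)]
    ([prox_of_quadratic_minorant]), and [- lam y] is the required multiplier. *)

Set Implicit Arguments.
Unset Strict Implicit.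
Unset Printing Implicit Defensive.

Import Order.TTheory GRing.Theory Num.Theory.
Import numFieldNormedType.Exports.

Local Open Scope classical_set_scope.
Local Open Scope ring_scope.

(** * Inner products *)

Section InnerProductGeometry.
Variables (R : realType) (X : euclideanType R).
Implicit Types x y z : X.

Lemma inner0l x : inner 0 x = 0.
Proof. by rewrite -(scale0r (0 : X)) innerZl mul0r. Qed.

Lemma inner0r x : inner x 0 = 0.
Proof. by rewrite innerC inner0l. Qed.

Lemma innerNl x y : inner (- x) y = - inner x y.
Proof. by rewrite -scaleN1r innerZl mulN1r. Qed.

Lemma innerNr x y : inner x (- y) = - inner x y.
Proof. by rewrite -scaleN1r innerZr mulN1r. Qed.

Lemma innerBr x y z : inner z (x - y) = inner z x - inner z y.
Proof. by rewrite innerDr innerNr. Qed.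

Lemma sqr_normD x y : `|x + y| ^+ 2 = `|x| ^+ 2 + 2 * inner x y + `|y| ^+ 2.
Proof.
rewrite -!inner_norm !(innerDl, innerDr) (innerC y x) -!addrA; congr (_ + _).
by rewrite mulr_natl mulr2n -!addrA.
Qed.

Lemma sqr_normB x y : `|x - y| ^+ 2 = `|x| ^+ 2 - 2 * inner x y + `|y| ^+ 2.
Proof. by rewrite sqr_normD innerNr normrN mulrN. Qed.

(** Expanding the square of the norm of [|y|^2 x - <x, y> y] gives
    [|y|^2 (|x|^2 |y|^2 - <x, y>^2)]. *)
Lemma cauchy_schwarz x y : `|inner x y| <= `|x| * `|y|.
Proof.
have [->|y0] := eqVneq y 0.
  by rewrite inner0r !normr0 mulr0.
rewrite -(@ler_pXn2r _ 2) ?nnegrE ?mulr_ge0//.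
rewrite exprMn real_normK ?num_real//.
have yy : 0 < `|y| ^+ 2 by rewrite exprn_gt0 ?normr_gt0.
have := sqr_ge0 `|(`|y| ^+ 2) *: x - inner x y *: y|.
rewrite sqr_normB !normrZ innerZl innerZr !exprMn !real_normK ?num_real// => h.
rewrite -subr_ge0 -(pmulr_rge0 _ yy); apply: le_trans h _.
by rewrite le_eqVlt; apply/orP; left; apply/eqP; ring.
Qed.

End InnerProductGeometry.

(** * Topology of Euclidean spaces *)

Section Coordinates.
Variables (R : realType).

Lemma rV_linear_continuous (V : normedModType R) n (M : {linear 'rV[R]_n -> V}) :
  continuous M.
Proof.
have -> : (M : 'rV[R]_n -> V) = (fun v => \sum_i v ord0 i *: M 'e_i).
  apply/funext => v; rewrite [in LHS](row_sum_delta v) linear_sum.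
  by apply: eq_bigr => i _; rewrite linearZ.
apply: (continuous_big (op := +%R)) => [|i _ v]; first exact: add_continuous.
by apply: (cvgZr_tmp (F := nbhs v)); exact: coord_continuous.
Qed.

Variable X : euclideanType R.

(** The coordinates are the inner products with the vectors of a basis, and not
    the coefficients on that basis: Cauchy-Schwarz then bounds [L] at once, while
    its left inverse [M] is continuous because its source is a space of rows. *)
Lemma euclidean_coordinates : exists n (L : {linear X -> 'rV[R]_n})
    (M : {linear 'rV[R]_n -> X}),
  cancel L M /\ exists C, forall x, `|L x| <= C * `|x|.
Proof.
pose e := vbasis {:X}; pose n := \dim {:X}.
pose phi (x : X) : 'rV[R]_n := \row_i inner e`_i x.
have lphi : linear phi.
  by move=> a x x'; apply/rowP => i; rewrite !mxE innerDr innerZr.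
pose PhiL := GRing.isLinear.Build R X _ _ phi lphi.
pose Phi : {linear X -> 'rV[R]_n} := HB.pack phi PhiL.
pose L := linfun Phi.
have kL : lker L == 0%VS.
  rewrite -subv0; apply/subvP => x; rewrite memv_ker lfunE /= memv0 => /eqP Lx0.
  rewrite -inner_eq0 {1}(coord_vbasis (memvf x)) inner_suml big1 // => i _.
  have := congr1 (fun r : 'rV[R]_n => r 0 i) Lx0.
  by rewrite !mxE innerZl => ->; rewrite mulr0.
exists n, L, (L^-1)%VF; split; first exact: lker0_lfunK.
exists (\sum_(i < n) `|e`_i|) => x.
rewrite [leLHS]/Num.norm /= mx_normrE; apply/bigmax_leP; split.
  by rewrite mulr_ge0// sumr_ge0.
move=> [i j] _ /=; rewrite lfunE/= mxE; apply: le_trans (cauchy_schwarz _ _) _.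
rewrite ler_wpM2r// (bigD1 j)//= lerDl sumr_ge0//.
Qed.

Lemma euclidean_linear_continuous (V : normedModType R) (A : {linear X -> V}) :
  continuous A.
Proof.
have [n [L [M [LK [C LC]]]]] := euclidean_coordinates.
have -> : (A : X -> V) = (A \o M) \o L by apply/funext => x /=; rewrite LK.
move=> x; apply: continuous_comp; last exact: rV_linear_continuous.
apply: bounded_linear_continuous; apply/linear_boundedP.
exists C; split=> [|r Cr y]; first exact: num_real.
by apply: le_trans (LC y) _; rewrite ler_wpM2r// ltW.
Qed.

(** [K] is a closed subset of the continuous image under [M] of a compact ball
    of coordinates. *)
Lemma euclidean_bounded_closed_compact (K : set X) (r : R) (c : X) :
  closed K -> (forall x, K x -> `|x - c| <= r) -> compact K.
Proof.
have [n [L [M [LK [C LC]]]]] := euclidean_coordinates.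
move=> Kcl Kr.
pose B := closed_ball_ Num.norm (L c) (`|C| * r).
have Bc : compact B.
  apply: bounded_closed_compact; last exact: closed_closed_ball_.
  exists (`|L c| + `|C| * r); split=> [|s rs v /= Bv]; first exact: num_real.
  apply: le_trans (ltW rs); rewrite -[v](subKr (L c)).
  by apply: le_trans (ler_normB _ _) _; rewrite lerD2l.
apply: (subclosed_compact Kcl (continuous_compact _ Bc)) => [|x Kx].
  exact/continuous_subspaceT/rV_linear_continuous.
exists (L x); last exact: LK.
rewrite /B /closed_ball_ /= -linearB; apply: le_trans (LC _) _.
apply: le_trans (_ : `|C| * `|c - x| <= _); first by rewrite ler_wpM2r ?ler_norm.
by rewrite distrC ler_wpM2l ?Kr.
Qed.

End Coordinates.

(** * Normals of affine subspaces *)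

Section AffineConstraint.
Variables (R : realType) (X Y : euclideanType R) (A : {linear X -> Y}).

Lemma inner_inj (Z : euclideanType R) (x x' : Z) :
  (forall u, inner u x = inner u x') -> x = x'.
Proof.
move=> h; apply/eqP; by rewrite -subr_eq0 -inner_eq0 innerBr h subrr.
Qed.

Lemma adjoint_linear : linear (adjoint A).
Proof.
move=> a y y'; apply: inner_inj => u.
by rewrite innerDr innerZr !adjointP innerDr innerZr.
Qed.

Hypothesis A_surj : forall y, exists x, A x = y.

(** If [A A^* v = 0] then [|A^* v|^2 = <A A^* v, v> = 0], so [v] is orthogonal to
    the range of [A], which is everything. Hence [A A^*] is an injective
    endomorphism of a finite-dimensional space. *)
Lemma gram_surjective y : exists y', A (adjoint A y') = y.
Proof.
pose G y' := A (adjoint A y').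
have lG : linear G.
  by move=> a u v; rewrite /G adjoint_linear linearP.
pose GL := GRing.isLinear.Build R Y Y _ G lG.
pose GG : {linear Y -> Y} := HB.pack G GL.
pose L := linfun GG.
have kL : lker L == 0%VS.
  rewrite -subv0; apply/subvP => v; rewrite memv_ker lfunE /= memv0 => /eqP Gv0.
  have Av0 : adjoint A v = 0.
    apply/eqP; rewrite -inner_eq0 adjointP -/(G v) Gv0.
    by rewrite inner0l.
  have [u uv] := A_surj v.
  rewrite -inner_eq0 -{1}uv -adjointP Av0.
  by rewrite inner0r.
have dL : (limg L = fullv)%VS.
  apply/eqP; rewrite eqEdim subvf /= limg_dim_eq //.
  by rewrite (eqP kL) capv0.
have /memv_imgP[y' _ yy'] : y \in limg L by rewrite dL memvf.
by exists y'; rewrite yy' lfunE.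
Qed.

(** Choose [y] with [A A^* y = A w]. Then [w - A^* y] lies in the kernel of [A],
    so it is orthogonal to [w], and also to the range of [A^*]. *)
Lemma kernel_orthogonal_range_adjoint w :
  (forall k, A k = 0 -> inner w k = 0) -> exists y, w = adjoint A y.
Proof.
move=> wk; have [y Ay] := gram_surjective (A w); exists y.
have Ak : A (w - adjoint A y) = 0 by rewrite linearB /= Ay subrr.
apply/eqP; rewrite -subr_eq0 -inner_eq0 {1}innerDl wk// innerNl add0r.
by rewrite innerC adjointP Ak inner0l oppr0.
Qed.

Variable b : Y.
Let E := [set x : X | A x = b].

(** The indicator vanishes along the line [x + t k], so the subgradient
    inequality forces [<w, k> <= e |k|] for every [e > 0]; then use [- k]. *)
Lemma regular_subdiff_affine x w k :
  regular_subdiff (indicator_fun E) x w -> A k = 0 -> inner w k = 0.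
Proof.
move=> [xfin wsub] Ak.
have Ex : E x.
  by move: xfin; rewrite /indicator_fun; case: asboolP.
suff le0 k' : A k' = 0 -> inner w k' <= 0.
  apply/eqP; rewrite eq_le le0//= -oppr_le0 -innerNr le0//.
  by rewrite linearN Ak oppr0.
move=> {Ak}Ak; rewrite leNgt; apply/negP => wk'.
have k0 : 0 < `|k'|.
  rewrite normr_gt0; apply: contraTneq wk' => ->.
  by rewrite inner0r ltxx.
(* Half of the slope [<w, k'> / |k'|] that is to be refuted. *)
pose e := inner w k' / (2 * `|k'|).
have e0 : 0 < e by rewrite divr_gt0// mulr_gt0.
have /nbhs_ballP[r /= r0 rsub] := wsub e e0.
pose t := r / (2 * `|k'|).
have t0 : 0 < t by rewrite divr_gt0// mulr_gt0.
have := rsub (x + t *: k').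
rewrite -ball_normE /ball_ /= opprD addrA subrr sub0r normrN normrZ gtr0_norm//.
have -> : t * `|k'| = r / 2 by rewrite /t; field; rewrite gt_eqF.
rewrite ltr_pdivrMr// ltr_pMr// ltr1n => /(_ isT).
have E' : E (x + t *: k') by rewrite /E /= linearD linearZ /= Ak scaler0 addr0.
rewrite /indicator_fun !asboolT// add0e lee_fin addrAC subrr add0r.
rewrite innerZr normrZ gtr0_norm//.
have -> : t * inner w k' - e * (t * `|k'|) = t * inner w k' / 2.
  by rewrite /e; field; rewrite gt_eqF.
by rewrite leNgt divr_gt0// mulr_gt0.
Qed.

(** Every regular normal is orthogonal to the kernel of [A], whatever its base
    point, and orthogonality passes to the limit. *)
Lemma limiting_subdiff_affine x w k :
  limiting_subdiff (indicator_fun E) x w -> A k = 0 -> inner w k = 0.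
Proof.
move=> [_ [u [v [_ _ vsub vw]]]] Ak.
apply/eqP; rewrite -normr_eq0; apply/negPn/negP => wk.
have wk0 : 0 < `|inner w k| by rewrite lt_neqAle eq_sym wk normr_ge0.
have k0 : 0 < `|k|.
  rewrite normr_gt0; apply: contraTneq wk0 => ->.
  by rewrite inner0r normr0 ltxx.
have /cvgrPdist_lt/(_ (`|inner w k| / `|k|)) := vw.
rewrite divr_gt0// => /(_ isT)[n _ /(_ n (leqnn n))] /=.
rewrite ltr_pdivlMr// => h; have := le_lt_trans (cauchy_schwarz _ _) h.
by rewrite innerDl innerNl (regular_subdiff_affine (vsub n) Ak) subr0 ltxx.
Qed.

End AffineConstraint.

(** * Minimization of lower semicontinuous functions *)

Section LowerSemicontinuity.

(** If no point of [K] were minimal, the sublevel sets at the points of [K] would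
    form a filter base; at a cluster point [x] of it, lower semicontinuity
    contradicts the choice of a point of [K] with a smaller value. *)
Lemma lsc_compact_min (R : realType) (T : topologicalType) (K : set T)
    (g : T -> \bar R) :
  compact K -> K !=set0 -> lower_semicontinuous g ->
  exists2 x, K x & forall y, K y -> (g x <= g y)%E.
Proof.
move=> Kc [k0 Kk0] glsc; apply: contrapT => nomin.
have noK x : K x -> exists2 y, K y & (g y < g x)%E.
  move=> Kx; apply: contrapT => ny; apply: nomin; exists x => // y Ky.
  by rewrite leNgt; apply/negP => yx; apply: ny; exists y.
pose F := filter_from K (fun y => K `&` [set x | (g x <= g y)%E]).
have FF : ProperFilter F.
  apply: filter_from_proper; last by move=> y Ky; exists y; split => /=.
  apply: filter_from_filter; first by exists k0.
  move=> y1 y2 Ky1 Ky2; have [le12|/ltW le21] := leP (g y1) (g y2).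
    exists y1 => // x [Kx /= x1]; split; split=> //=; exact: le_trans le12.
  exists y2 => // x [Kx /= x1]; split; split=> //=; exact: le_trans le21.
have [|x [Kx clx]] := Kc F FF; first by exists k0 => // x [].
have [y Ky yx] := noK x Kx.
(* A real level is needed between the two extended values; [g y] itself is one,
   as there are values of [g] on both sides of it. *)
have [a ya ax] : exists2 a : R, (g y <= a%:E)%E & (a%:E < g x)%E.
  have [z Kz zy] := noK y Ky.
  case: (g y) yx zy => [r|+ _|_]; first by exists r.
    by rewrite ltNge leey.
  by rewrite ltNge leNye.
have [V xV Va] := glsc x a ax.
have Fy : F (K `&` [set x | (g x <= g y)%E]) by exists y.
have [z [[_ /= zy] /Va]] := clx _ _ Fy xV.
by rewrite ltNge (le_trans zy ya).
Qed.

Variables (R : realType) (X : euclideanType R).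

Lemma lsc_prox_objective (f : X -> \bar R) (c : R) (z : X) :
  0 < c -> lower_semicontinuous f ->
  (forall x, f x != -oo%E) ->
  lower_semicontinuous (prox_objective (escale c f) z).
Proof.
move=> c0 flsc fNy x a ax.
pose q0 := 2^-1 * `|x - z| ^+ 2.
have [p [q [px qx apq]]] : exists p q : R,
    [/\ (p%:E < f x)%E, q < q0 & a <= c * p + q].
  move: ax; rewrite /prox_objective /escale -/q0.
  case: (f x) (fNy x) => [r _|_ _|//].
    rewrite -EFinM -EFinD lte_fin => ar; pose d := c * r + q0 - a.
    have d0 : 0 < d by rewrite subr_gt0.
    exists (r - d / (2 * c)), (q0 - d / 2); split.
    - by rewrite lte_fin ltrBlDr ltrDl divr_gt0// mulr_gt0.
    - by rewrite ltrBlDr ltrDl divr_gt0.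
    - rewrite le_eqVlt; apply/orP; left; apply/eqP; rewrite /d; field.
      by rewrite gt_eqF.
  exists ((a - q0 + 1) / c), (q0 - 1); split.
  - exact: ltry.
  - by rewrite ltrBlDr ltrDl.
  - by rewrite mulrC divfK ?gt_eqF// le_eqVlt; apply/orP; left; apply/eqP; ring.
have [V xV Vp] := flsc x p px.
have : \forall y \near x, q < 2^-1 * `|y - z| ^+ 2.
  have qc : 2^-1 * `|y - z| ^+ 2 @[y --> x] --> q0.
    apply: cvgM; first exact: cvg_cst.
    have nc : `|y - z| @[y --> x] --> `|x - z|.
      by apply: cvg_norm; apply: cvgB; [exact: cvg_id | exact: cvg_cst].
    exact: (continuous_cvg _ (@exprn_continuous R 2 _) nc).
  exact: (cvgr_gt q0 qc).
move=> qV; exists (V `&` [set y | q < 2^-1 * `|y - z| ^+ 2]); first exact: filterI.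
move=> y [/Vp py qy]; rewrite /prox_objective /escale.
apply: (@le_lt_trans _ _ (c * p + q)%:E); first by rewrite lee_fin.
rewrite EFinD EFinM lteD// ?lte_fin//.
by rewrite lte_pmul2l// ?lte_fin.
Qed.

End LowerSemicontinuity.

(** * Quadratic minorants and proximal points *)

Section ProximalEstimates.
Variables (R : realType) (X : euclideanType R) (f : X -> \bar R) (c : R).
Hypothesis c_gt0 : 0 < c.
Hypothesis f_neq_ninfty : forall x, f x != -oo%E.

(** Completing the square: the minorant says exactly that the proximal objective
    centred at [x + c u] is smallest at [x]. *)
Lemma prox_of_quadratic_minorant x u :
  f x \is a fin_num ->
  (forall y, (f x + (inner u (y - x) - (2 * c)^-1 * `|y - x| ^+ 2)%:E
    <= f y)%E) ->
  prox (escale c f) (x + c *: u) x.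
Proof.
move=> xfin minor y; move: (minor y); rewrite /prox_objective /escale.
rewrite -(fineK xfin); set a := fine (f x).
case: (f y) (f_neq_ninfty y) => [s _|_ _|//]; last first.
  by rewrite gt0_muley ?lte_fin// addye// leey.
rewrite -!EFinM -!EFinD !lee_fin.
have -> : x - (x + c *: u) = - (c *: u) by rewrite opprD addrA subrr sub0r.
have -> : y - (x + c *: u) = (y - x) - c *: u by rewrite opprD addrA.
rewrite normrN (sqr_normB (y - x)) innerZr (innerC u) -(ler_pM2l c_gt0) => h.
rewrite -subr_ge0; move: h; rewrite -subr_ge0 => /le_trans; apply.
rewrite le_eqVlt; apply/orP; left; apply/eqP; field.
by rewrite gt_eqF.
Qed.

(** Minimality gives a quadratic minorant of [f] on [E], with slope
    [c^-1 (z - x)] and error [|y - x|^2 / (2 c)]; this error is at most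
    [e |y - x|] within distance [2 c e] of [x]. *)
Lemma constrained_min_regular_subdiff (E : set X) z x :
  f x \is a fin_num -> E x ->
  (forall y, E y -> (prox_objective (escale c f) z x
     <= prox_objective (escale c f) z y)%E) ->
  regular_subdiff (f \+ indicator_fun E)%E x (c^-1 *: (z - x)).
Proof.
move=> xfin Ex xmin; split.
  by rewrite /= /indicator_fun asboolT// adde0.
move=> e e0; apply/nbhs_ballP; exists (2 * c * e) => /=; first by rewrite !mulr_gt0.
move=> y; rewrite -ball_normE /ball_ /= distrC => yx.
rewrite /indicator_fun asboolT// adde0; case: asboolP => [Ey|_]; last first.
  by rewrite addey ?leey.
rewrite adde0; move: (xmin y Ey); rewrite /prox_objective /escale.
rewrite -(fineK xfin); set a := fine (f x).
case: (f y) (f_neq_ninfty y) => [s _|_ _|//]; last by rewrite leey.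
rewrite -!EFinM -!EFinD !lee_fin.
have -> : y - z = (y - x) - (z - x) by rewrite opprB addrA subrK.
rewrite (sqr_normB (y - x)) (distrC x z) innerZl (innerC (z - x)) => h.
rewrite -(ler_pM2l c_gt0) mulrDr mulrBr mulrA divff ?gt_eqF// mul1r.
have := ler_wpM2r (normr_ge0 (y - x)) (ltW yx).
rewrite -expr2; lra.
Qed.

Variables (rho : R) (xbar : X).
Hypothesis crho_lt1 : c * rho < 1.
Hypothesis xbar_fin : f xbar \is a fin_num.
Hypothesis global_minorant : forall y,
  (f xbar + (- (rho / 2 * `|y - xbar| ^+ 2))%:E <= f y)%E.

(** The objective at [y] exceeds its value at [xbar] by at least
    [(1 - c rho) D^2 / 2 - D |z - xbar|], where [D = |y - xbar|]. This confines
    the constrained minimizers to a ball whose radius is proportional to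
    [|z - xbar|]. *)
Lemma prox_objective_far z y :
  2 * `|z - xbar| < (1 - c * rho) * `|y - xbar| ->
  (prox_objective (escale c f) z xbar < prox_objective (escale c f) z y)%E.
Proof.
move=> far; have k0 : 0 < 1 - c * rho by rewrite subr_gt0.
have D0 : 0 < `|y - xbar|.
  by rewrite -(pmulr_rgt0 _ k0); apply: le_lt_trans far; rewrite mulr_ge0.
move: (global_minorant y); rewrite /prox_objective /escale.
rewrite -(fineK xbar_fin); set a := fine (f xbar).
case: (f y) (f_neq_ninfty y) => [s _|_ _|//]; last first.
  by rewrite gt0_muley ?lte_fin// addye// ltry.
rewrite -!EFinM -!EFinD lee_fin lte_fin -(ler_pM2l c_gt0) => h.
have -> : y - z = (y - xbar) - (z - xbar) by rewrite opprB addrA subrK.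
rewrite (sqr_normB (y - xbar)) (distrC xbar z).
have := cauchy_schwarz (y - xbar) (z - xbar).
move=> /(le_trans (ler_norm _)) i_le.
rewrite -(ltr_pM2l D0) in far.
move: h far i_le; set D := `|y - xbar|; set e := `|z - xbar|.
set i := inner _ _ => h1 h2 h3.
lra.
Qed.

(** Globally the curvature of the minorant is relaxed from [rho] to [1 / c].
    When [D = |y - xbar| >= r], the minorant based at [xbar] leaves a margin
    [(1 - c rho) D^2], after multiplication by [2 c]; each of the three smallness
    hypotheses keeps one of the errors (in the value at [x], in the position of
    [x], in the slope [u]) below a quarter of this margin. *)
Lemma local_to_global_minorant r eta x u :
  0 < r ->
  (f x <= f xbar + eta%:E)%E ->
  8 * c * eta <= (1 - c * rho) * r ^+ 2 ->
  8 * `|x - xbar| <= (1 - c * rho) * r ->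
  16 * c * `|u| <= (1 - c * rho) * r ->
  0 <= rho ->
  (forall y, ball xbar r y ->
    (f x + (inner u (y - x) - rho / 2 * `|y - x| ^+ 2)%:E <= f y)%E) ->
  forall y, (f x + (inner u (y - x) - (2 * c)^-1 * `|y - x| ^+ 2)%:E <= f y)%E.
Proof.
move=> r0 fx eta_small x_near u_small rho0 local y.
have k0 : 0 < 1 - c * rho by rewrite subr_gt0.
have [near|far] := ltP `|y - xbar| r.
  apply: le_trans (local y _); last by rewrite -ball_normE /ball_ /= distrC.
  rewrite leeD2l// lee_fin lerD2l lerN2 ler_wpM2r ?sqr_ge0//.
  rewrite -(ler_pM2l c_gt0).
  have -> : c * (2 * c)^-1 = 2^-1 by field; rewrite gt_eqF.
  by rewrite mulrA ler_pdivrMr// mulVf// ltW.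
have xfin : f x \is a fin_num.
  rewrite fin_numE f_neq_ninfty -ltey; apply: le_lt_trans fx _.
  by rewrite -(fineK xbar_fin) -EFinD ltry.
move: (global_minorant y) fx; rewrite -(fineK xbar_fin) -(fineK xfin).
set a := fine (f xbar); set ax := fine (f x).
case: (f y) (f_neq_ninfty y) => [s _|_ _|//]; last by rewrite leey.
rewrite -!EFinD !lee_fin => glob axa.
have iu := le_trans (ler_norm _) (cauchy_schwarz u (y - x)).
have ix := le_trans (ler_norm _) (cauchy_schwarz (y - xbar) (x - xbar)).
have yxE : y - x = (y - xbar) - (x - xbar) by rewrite opprB addrA subrK.
have tri : `|y - x| <= `|y - xbar| + `|x - xbar|.
  by rewrite yxE ler_normB.
have sqE := sqr_normB (y - xbar) (x - xbar).
rewrite -yxE in sqE.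
have k1 : 1 - c * rho <= 1 by rewrite gerBl mulr_ge0// ltW.
set k := 1 - c * rho in k0 k1 eta_small x_near u_small *.
set D := `|y - xbar| in far glob ix tri sqE *.
set d := `|x - xbar| in x_near ix tri sqE *.
set U := `|u| in u_small iu *.
have d0 : 0 <= d by rewrite normr_ge0.
have U0 : 0 <= U by rewrite normr_ge0.
have D0 : 0 < D := lt_le_trans r0 far.
have krD : k * r <= k * D by rewrite ler_pM2l.
have krr : k * r ^+ 2 <= k * D ^+ 2.
  by rewrite ler_pM2l// ler_pXn2r// nnegrE ltW.
have dD : 8 * (D * d) <= k * D ^+ 2.
  have := ler_wpM2l (ltW D0) (le_trans x_near krD); rewrite !mulrA; lra.
have dle : d <= D.
  have : k * D <= 1 * D by rewrite ler_wpM2r// ltW.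
  by lra.
have cUD : 16 * (c * (U * D)) <= k * D ^+ 2.
  have := ler_wpM2l (ltW D0) (le_trans u_small krD); rewrite !mulrA; lra.
have iuU : c * inner u (y - x) <= 2 * (c * (U * D)).
  rewrite mulrCA ler_pM2l//; apply: le_trans iu _.
  have -> : 2 * (U * D) = U * (D + D) by ring.
  by rewrite ler_wpM2l// (le_trans tri)// lerD2l.
have cglob := ler_wpM2l (ltW c_gt0) glob.
have caxa := ler_wpM2l (ltW c_gt0) axa.
rewrite -(ler_pM2l c_gt0).
have -> : c * (ax + (inner u (y - x) - (2 * c)^-1 * `|y - x| ^+ 2)) =
  c * ax + c * inner u (y - x) - `|y - x| ^+ 2 / 2 by field; rewrite gt_eqF.
rewrite sqE.
have d20 := sqr_ge0 d.
have kE : k * D ^+ 2 = D ^+ 2 - c * rho * D ^+ 2 by rewrite /k; ring.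
nra.
Qed.

End ProximalEstimates.

Section ConstrainedProximalPoint.
Variables (R : realType) (X Y : euclideanType R).
Variables (f : X -> \bar R) (A : {linear X -> Y}) (b : Y) (c rho : R) (xbar : X).
Hypothesis c_gt0 : 0 < c.
Hypothesis f_neq_ninfty : forall x, f x != -oo%E.
Hypothesis f_lsc : lower_semicontinuous f.
Hypothesis crho_lt1 : c * rho < 1.
Hypothesis xbar_fin : f xbar \is a fin_num.
Hypothesis Axbar : A xbar = b.
Hypothesis global_minorant : forall y,
  (f xbar + (- (rho / 2 * `|y - xbar| ^+ 2))%:E <= f y)%E.

(** By [prox_objective_far] nothing is lost by minimizing over the compact part of
    the affine set at distance at most [2 |z - xbar| / (1 - c rho)] from
    [xbar]. *)
Lemma constrained_min_near z : exists x,
  [/\ A x = b,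
      (1 - c * rho) * `|x - xbar| <= 2 * `|z - xbar|,
      (f x <= f xbar + (`|z - xbar| ^+ 2 / (2 * c))%:E)%E &
      forall y, A y = b -> (prox_objective (escale c f) z x
        <= prox_objective (escale c f) z y)%E].
Proof.
have k0 : 0 < 1 - c * rho by rewrite subr_gt0.
pose r := 2 * `|z - xbar| / (1 - c * rho).
pose K := [set x | A x = b] `&` closed_ball_ Num.norm xbar r.
have Kxbar : K xbar.
  split=> //; rewrite /closed_ball_ /= subrr normr0.
  by rewrite divr_ge0 ?mulr_ge0// ltW.
have Kcompact : compact K.
  apply: (@euclidean_bounded_closed_compact _ _ K r xbar); last first.
    by move=> x [_]; rewrite /closed_ball_ /= distrC.
  apply: closedI; last exact: closed_closed_ball_.
  apply: (preimage_closed (f := A) (D := [set b])) => [x _|].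
    exact: euclidean_linear_continuous.
  exact: accessible_closed_set1 (hausdorff_accessible (@norm_hausdorff _ _)) _.
have [|x [Ax xr] xmin] := lsc_compact_min Kcompact _
    (lsc_prox_objective (z := z) c_gt0 f_lsc f_neq_ninfty); first by exists xbar.
have xmin' y : A y = b -> (prox_objective (escale c f) z x
        <= prox_objective (escale c f) z y)%E.
  move=> Ay; have [yr|yr] := leP `|xbar - y| r; first exact: xmin.
  apply: le_trans (xmin _ Kxbar) (ltW _).
  apply: (prox_objective_far c_gt0 f_neq_ninfty crho_lt1 xbar_fin global_minorant).
  by rewrite (distrC y) [X in _ < X]mulrC -ltr_pdivrMr//.
exists x; split=> //.
  by rewrite (distrC x) [X in X <= _]mulrC -ler_pdivlMr//.
move: (xmin _ Kxbar); rewrite /prox_objective /escale -(fineK xbar_fin).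
set a := fine (f xbar).
case: (f x) (f_neq_ninfty x) => [s _|_|//]; last first.
  by rewrite gt0_muley ?lte_fin// addye.
rewrite -!EFinM -!EFinD !lee_fin (distrC xbar z) => h.
rewrite -(ler_pM2l c_gt0) mulrDr.
have -> : c * (`|z - xbar| ^+ 2 / (2 * c)) = 2^-1 * `|z - xbar| ^+ 2.
  by field; rewrite gt_eqF.
by apply: le_trans h; rewrite lerDl mulr_ge0 ?sqr_ge0.
Qed.

End ConstrainedProximalPoint.

(** The proximal objective at [xbar] is compared with its value at [y]; as [y] is
    arbitrary, the minorant holds on the whole space, which is what makes the
    constrained minimizers exist and localize. *)
Lemma prox_quadratic_minorant (R : realType) (X : euclideanType R)
    (f : X -> \bar R) (rho : R) (xbar : X) :
  0 < rho -> (forall x, f x != -oo%E) -> f xbar \is a fin_num ->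
  prox (escale rho^-1 f) xbar xbar ->
  forall y, (f xbar + (- (rho / 2 * `|y - xbar| ^+ 2))%:E <= f y)%E.
Proof.
move=> rho0 fNy xfin + y => /(_ y); rewrite /prox_objective /escale.
rewrite -(fineK xfin); set a := fine (f xbar).
case: (f y) (fNy y) => [s _|_ _|//]; last by rewrite leey.
rewrite -!EFinM -!EFinD !lee_fin subrr normr0 expr0n mulr0 addr0.
rewrite -(ler_pM2l rho0) mulrDr !mulrA divff ?gt_eqF// !mul1r; lra.
Qed.

Lemma regular_limiting_subdiff (R : realType) (X : euclideanType R)
    (f : X -> \bar R) (x v : X) :
  regular_subdiff f x v -> limiting_subdiff f x v.
Proof.
move=> fv; split; first by case: fv.
by exists (fun=> x), (fun=> v); split=> //; exact: cvg_cst.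
Qed.

(** * Dual representability near the reference point *)

Theorem theorem2 (R : realType) (X Y : euclideanType R) (lam : R) (b : Y)
    (f : X -> \bar R) (A : {linear X -> Y}) (xbar : X) (rho : R)
    (lam_gt0 : 0 < lam)
    (f_neq_ninfty : forall x, f x != -oo%E)
    (f_proper : edom f !=set0)
    (f_lsc : lower_semicontinuous f)
    (f_prox_bounded : prox_bounded f)
    (lam_lt_threshold : (lam%:E < prox_threshold f)%E)
    (A_surj : forall y : Y, exists x : X, A x = y)
    (xbar_feasible : ([set x | A x = b] `&` edom f) xbar)
    (nssr : NSSR f (indicator_fun [set x | A x = b]) xbar)
    (rho_bounds : 0 < rho < 1 / lam)
    (f_prox_regular : prox_regular f xbar 0 rho)
    (xbar_prox : prox (escale rho^-1 f) xbar = [set xbar]) :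
  exists2 eps : R, 0 < eps &
    forall z : X, `|z - xbar| < eps -> dual_representable f A b lam z.
Proof.
have [Axbar _] := xbar_feasible.
have /andP[rho0] := rho_bounds; rewrite ltr_pdivlMr// mulrC => crho.
have [xbar_fin _ _ [r r0 preg]] := f_prox_regular.
have glob y : (f xbar + (- (rho / 2 * `|y - xbar| ^+ 2))%:E <= f y)%E.
  by apply: prox_quadratic_minorant; rewrite ?xbar_prox.
have [tau [delta [tau0 delta0 sum_rule]]] := nssr.
set E := [set x | A x = b] in sum_rule.
have k0 : 0 < 1 - lam * rho by rewrite subr_gt0.
have k1 : 1 - lam * rho < 1 by rewrite ltrBlDr ltrDl mulr_gt0.
(* Subgradients shorter than [kappa] are admitted by prox-regularity and are
   short enough for the global estimate. *)
have [kappa kappa0 /andP[kr kk]] : exists2 kappa, 0 < kappa &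
    (kappa <= r) && (16 * lam * kappa <= (1 - lam * rho) * r).
  exists (Num.min r ((1 - lam * rho) * r / (16 * lam))).
    by rewrite lt_min r0 divr_gt0 ?mulr_gt0.
  rewrite ge_min lexx /= [X in X <= _]mulrC -ler_pdivlMr ?mulr_gt0//.
  by rewrite ge_min lexx orbT.
(* The sum rule turns a subgradient of the sum shorter than [eta] into a
   subgradient of [f] shorter than [tau * eta]. *)
have [eta eta0 /andP[eta1 etak]] : exists2 eta, 0 < eta &
    (eta <= 1) && (tau * eta <= kappa).
  exists (Num.min 1 (kappa / tau)); first by rewrite lt_min ltr01 divr_gt0.
  rewrite ge_min lexx /= [X in X <= _]mulrC -ler_pdivlMr//.
  by rewrite ge_min lexx orbT.
set k := 1 - lam * rho in k0 k1 kk *.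
(* [s] bounds the displacement of the constrained minimizer; the bounds by [1]
   and [lam * r] make the quadratic increase of [f] smaller than [r]. *)
have [s s0 [sdelta sr seta s1 slr]] : exists2 s, 0 < s &
    [/\ s <= delta, 8 * s <= k * r, s <= eta * lam, s <= 1 & s <= lam * r].
  exists (Num.min delta (Num.min (k * r / 8)
    (Num.min (eta * lam) (Num.min 1 (lam * r))))).
    by rewrite !lt_min delta0 ltr01 divr_gt0 ?mulr_gt0.
  rewrite [X in X <= k * r]mulrC -ler_pdivlMr//.
  by split; rewrite !ge_min lexx ?orbT.
exists (k * s / 4); first by rewrite divr_gt0 ?mulr_gt0.
move=> z zxbar.
have [x [Ax xnear fx xmin]] := constrained_min_near lam_gt0 f_neq_ninfty f_lsc
  crho xbar_fin Axbar glob z.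
have e0 : 0 <= `|z - xbar| by [].
have ks : k * s < s by rewrite gtr_pMl.
have es : 4 * `|z - xbar| < s by lra.
have ds : 2 * `|x - xbar| < s.
  by rewrite -(ltr_pM2l k0) -/k in xnear *; lra.
have e2 : `|z - xbar| ^+ 2 <= (k * s / 4) ^+ 2.
  by rewrite ler_pXn2r// ?nnegrE// ?ltW// divr_gt0 ?mulr_gt0.
have kss : (k * s / 4) ^+ 2 <= k * s / 16.
  rewrite (_ : _ ^+ 2 = k * s / 16 * (k * s)); last by field.
  by rewrite ger_pMr ?divr_gt0 ?mulr_gt0// (le_trans (ltW ks)).
have xfin : f x \is a fin_num.
  rewrite fin_numE f_neq_ninfty -ltey; apply: le_lt_trans fx _.
  by rewrite -(fineK xbar_fin) -EFinD ltry.
have v_sub := constrained_min_regular_subdiff lam_gt0 f_neq_ninfty xfin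
  (Ax : E x) xmin.
set v := lam^-1 *: (z - x) in v_sub.
have v_small : `|v| < eta.
  rewrite /v normrZ gtr0_norm ?invr_gt0// mulrC ltr_pdivrMr//.
  apply: lt_le_trans seta.
  have -> : z - x = (z - xbar) - (x - xbar) by rewrite opprB addrA subrK.
  by apply: le_lt_trans (ler_normB _ _) _; lra.
have x_delta : ball xbar delta x.
  by rewrite -ball_normE /ball_ /= distrC; lra.
have x_dom : edom f x by rewrite /edom /= -(fineK xfin) ltry.
have x_domE : edom (indicator_fun E) x.
  by rewrite /edom /= /indicator_fun asboolT// ltry.
have eta01 : 0 < eta <= 1 by rewrite eta0.
have [] := sum_rule x eta x_delta x_dom x_domE eta01 v.
  split; last by rewrite -ball_normE /ball_ /= sub0r normrN.
  exact: regular_limiting_subdiff.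
move=> u [u_sub [u' + uE]] [w [w_sub _] uw].
rewrite -ball_normE /ball_ /= sub0r normrN => u'_small.
have u_small : `|u| < kappa.
  rewrite -uE normrZ gtr0_norm//; apply: lt_le_trans etak.
  by rewrite ltr_pM2l.
have [y wy] := kernel_orthogonal_range_adjoint A_surj
  (fun k => limiting_subdiff_affine (b := b) (x := x) (k := k) w_sub).
(* The multiplier removes the normal part: [z - lam w = x + lam u]. *)
exists (- lam *: y), x; last by rewrite Ax subrr.
have -> : z + adjoint A (- lam *: y) = x + lam *: u.
  have -> : adjoint A (- lam *: y) = - lam *: w.
    apply: inner_inj => t.
    by rewrite adjointP !innerZr wy adjointP.
  have -> : u = v - w by rewrite -uw addrK.
  rewrite scalerBr scaleNr /v scalerA divff ?gt_eqF// scale1r.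
  by rewrite addrA subrKC.
apply: prox_of_quadratic_minorant => //.
apply: (local_to_global_minorant lam_gt0 f_neq_ninfty crho xbar_fin glob r0 fx).
- rewrite -/k.
  have -> : 8 * lam * (`|z - xbar| ^+ 2 / (2 * lam)) = 4 * `|z - xbar| ^+ 2.
    by field; rewrite gt_eqF.
  apply: (@le_trans _ _ (k * s ^+ 2 )).
    have : (k * s / 4) ^+ 2 <= k * s ^+ 2 / 16.
      rewrite (_ : _ ^+ 2 = k * s ^+ 2 / 16 * k); last by field.
      by rewrite ger_pMr ?divr_gt0 ?mulr_gt0 ?exprn_gt0// ltW.
    have : 0 < k * s ^+ 2 by rewrite mulr_gt0// exprn_gt0.
    lra.
  rewrite ler_pM2l// ler_pXn2r// ?nnegrE ?ltW//.
  have : k * r < r by rewrite gtr_pMl.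
  lra.
- by rewrite -/k; lra.
- rewrite -/k; apply: le_trans kk; rewrite ler_pM2l ?mulr_gt0//; exact: ltW.
- exact: ltW.
- move=> y' y'r; apply: preg => //.
  + rewrite -ball_normE /ball_ /= distrC.
    have : k * r < r by rewrite gtr_pMl.
    lra.
  + apply: le_lt_trans fx _; rewrite -(fineK xbar_fin) -!EFinD lte_fin ltrD2l.
    rewrite ltr_pdivrMr ?mulr_gt0//.
    have : 0 < lam * r by rewrite mulr_gt0.
    lra.
  + by rewrite -ball_normE /ball_ /= sub0r normrN; apply: lt_le_trans kr.
Qed.
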